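(* The unit speed space-like curve $f:I\to\mathbb{S}^2_1$ is a part of a pseudo-circle if and only if the corresponding space-like Bertrand curve $$\tilde\gamma(v)=a\int_0^v f(t)\,dt+a\tanh\xi_1\int_0^v f(t)\times f'(t)\,dt$$ is a helix, where $a$ and $\xi_1=\xi_1(u)=\tanh\theta\,\ln u$ are constants and $\theta$ is a constant different from $0$.
   Context: Minkowski 3-space $\mathbb{R}^3_1$ is $\mathbb{R}^3$ with $\langle x,y\rangle=x_1y_1+x_2y_2-x_3y_3$ and $\|x\|=\sqrt{|\langle x,x\rangle|}$. A vector $x$ is space-like if $\langle x,x\rangle>0$ or $x=0$, time-like if $\langle x,x\rangle<0$, light-like if $\langle x,x\rangle=0$ and $x\neq0$. A regular curve defined on an interval $I\subset\mathbb{R}$ is space-like (time-like) if all its velocity vectors are; it is unit speed if its velocity has pseudo-norm $1$. The Lorentzian cross product is $x\times y=(x_2y_3-x_3y_2,\;x_3y_1-x_1y_3,\;x_2y_1-x_1y_2)$, so that $\langle x\times y,z\rangle=\det(x,y,z)$. De Sitter 2-space is $\mathbb{S}^2_1=\{x\in\mathbb{R}^3_1:\langle x,x\rangle=1\}$. For $u_0\in\mathbb{S}^2_1$ and $r\in\mathbb{R}$, the pseudo-circle with center $u_0$ on $\mathbb{S}^2_1$ is $PS^1(u_0,r)=\{w\in\mathbb{S}^2_1:\langle w,u_0\rangle=r\}$. For a space-like curve $\alpha$ with arc-length parameter $s$, it is assumed that $T'(s)$ is space-like, where $T=\alpha'$. The Frenet frame is $T=\alpha'$, $N=\alpha''/\|\alpha''\|$,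 $B=N\times T$; the curvature is $\kappa=\|T'\|$ and the torsion is $\tau=-\langle N',B\rangle$. A space-like curve is a (space-like) Bertrand curve if and only if there are non-zero real constants $A,B$ such that $A\kappa(s)+B\tau(s)=1$ for all $s$. A helix is a curve which makes a constant angle with a fixed direction; if a space-like curve is a helix then $\tau/\kappa$ is constant, and conversely a space-like curve with non-light-like normal vector and $\tau/\kappa$ constant is a helix.
   Formalization: ''Helix'' is taken to mean a constant angle with a fixed space-like direction; with time-like directions allowed the claim fails, e.g. for f(t)=(cos t, sin t, 0), whose Bertrand curve is a helix with axis (0,0,1) though f lies on no pseudo-circle with center in de Sitter space. *)

(* Defs.v *)
From Stdlib Require Import Reals.
From Coquelicot Require Import Coquelicot.
Open Scope R_scope.

Definition V3 : Type := (R * R * R)%type.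

Definition x1 (x : V3) : R := fst (fst x).
Definition x2 (x : V3) : R := snd (fst x).
Definition x3 (x : V3) : R := snd x.

Definition vzero : V3 := (0, 0, 0).

Definition vadd (x y : V3) : V3 := (x1 x + x1 y, x2 x + x2 y, x3 x + x3 y).

Definition vscal (c : R) (x : V3) : V3 := (c * x1 x, c * x2 x, c * x3 x).

Definition ldot (x y : V3) : R := x1 x * x1 y + x2 x * x2 y - x3 x * x3 y.

Definition lnorm (x : V3) : R := sqrt (Rabs (ldot x x)).

(* The third coordinate is minus the Euclidean one, so that
   ldot (lcross x y) z = det (x, y, z). *)
Definition lcross (x y : V3) : V3 :=
  (x2 x * x3 y - x3 x * x2 y,
   x3 x * x1 y - x1 x * x3 y,
   x2 x * x1 y - x1 x * x2 y).

Definition spacelike (x : V3) : Prop := 0 < ldot x x \/ x = vzero.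

Definition de_sitter (x : V3) : Prop := ldot x x = 1.

Definition pseudo_circle (u0 : V3) (r : R) (w : V3) : Prop :=
  de_sitter w /\ ldot w u0 = r.

Definition vderive (g : R -> V3) (t : R) : V3 :=
  (Derive (fun s => x1 (g s)) t,
   Derive (fun s => x2 (g s)) t,
   Derive (fun s => x3 (g s)) t).

Definition vRInt (g : R -> V3) (p q : R) : V3 :=
  (RInt (fun s => x1 (g s)) p q,
   RInt (fun s => x2 (g s)) p q,
   RInt (fun s => x3 (g s)) p q).

(* Open, half-open, closed, bounded or not, but not reduced to a point. *)
Definition interval (I : R -> Prop) : Prop :=
  (forall p q t, I p -> I q -> p <= t <= q -> I t) /\
  (exists p q, I p /\ I q /\ p < q).

(* A curve on I is a total function of which only the values on I matter.
   If I contains an endpoint, smoothness there means, as usual, smoothness of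
   an extension to a neighbourhood; derivatives at the endpoint do not depend
   on the extension. *)
Definition smooth_on (I : R -> Prop) (g : R -> R) : Prop :=
  forall (n : nat) (t : R), I t -> locally t (fun s => ex_derive_n g n s).

Definition smooth_curve (I : R -> Prop) (alpha : R -> V3) : Prop :=
  smooth_on I (fun s => x1 (alpha s)) /\
  smooth_on I (fun s => x2 (alpha s)) /\
  smooth_on I (fun s => x3 (alpha s)).

Definition spacelike_curve (I : R -> Prop) (alpha : R -> V3) : Prop :=
  smooth_curve I alpha /\
  forall t, I t -> vderive alpha t <> vzero /\ spacelike (vderive alpha t).

Definition unit_speed (I : R -> Prop) (alpha : R -> V3) : Prop :=
  forall t, I t -> lnorm (vderive alpha t) = 1.

(* Derivative of g with respect to the arc length s of alpha, expressed in the
   given parameter t: d/ds = (1 / ||alpha'(t)||) d/dt.  The Frenet apparatus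
   below is thus that of the arc-length reparametrization of alpha. *)
Definition Ds (alpha : R -> V3) (g : R -> V3) (t : R) : V3 :=
  vscal (/ lnorm (vderive alpha t)) (vderive g t).

Definition frenet_T (alpha : R -> V3) : R -> V3 := Ds alpha alpha.

Definition curvature (alpha : R -> V3) (t : R) : R :=
  lnorm (Ds alpha (frenet_T alpha) t).

Definition frenet_N (alpha : R -> V3) (t : R) : V3 :=
  vscal (/ curvature alpha t) (Ds alpha (frenet_T alpha) t).

Definition frenet_B (alpha : R -> V3) (t : R) : V3 :=
  lcross (frenet_N alpha t) (frenet_T alpha t).

Definition torsion (alpha : R -> V3) (t : R) : R :=
  - ldot (Ds alpha (frenet_N alpha) t) (frenet_B alpha t).

(* The derivative of the tangent must be non-zero for N to be defined; this is
   not part of being space-like, since the zero vector is space-like. *)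
Definition frenet_curve (I : R -> Prop) (alpha : R -> V3) : Prop :=
  spacelike_curve I alpha /\
  forall t, I t ->
    Ds alpha (frenet_T alpha) t <> vzero /\
    spacelike (Ds alpha (frenet_T alpha) t).

Definition bertrand (I : R -> Prop) (alpha : R -> V3) : Prop :=
  frenet_curve I alpha /\
  exists A B : R, A <> 0 /\ B <> 0 /\
    forall t, I t -> A * curvature alpha t + B * torsion alpha t = 1.

(* For non-zero space-like x and y this number determines the angle between
   them: it is the cosine if they span a space-like plane, and plus or minus
   the hyperbolic cosine if they span a time-like plane. *)
Definition angle_ratio (x y : V3) : R := ldot x y / (lnorm x * lnorm y).

(* The fixed direction d has the causal character of the tangent, so that the
   angle is one between space-like vectors.  If time-like directions were
   allowed, the curve built from the circle f(t) = (cos t, sin t, 0) would be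
   a helix with axis (0, 0, 1), while that circle lies on no pseudo-circle
   with centre in de Sitter space. *)
Definition helix (I : R -> Prop) (alpha : R -> V3) : Prop :=
  exists (d : V3) (c : R), d <> vzero /\ spacelike d /\
    forall t, I t -> angle_ratio (frenet_T alpha t) d = c.

Definition part_of_pseudo_circle (I : R -> Prop) (f : R -> V3) : Prop :=
  exists (u0 : V3) (r : R), de_sitter u0 /\
    forall t, I t -> pseudo_circle u0 r (f t).

Definition xi1 (theta u : R) : R := tanh theta * ln u.

Definition gamma_tilde (a xi : R) (f : R -> V3) (v : R) : V3 :=
  vadd (vscal a (vRInt f 0 v))
       (vscal (a * tanh xi)
              (vRInt (fun t => lcross (f t) (vderive f t)) 0 v)).

(* Main.v *)
Require Import Defs.
From Stdlib Require Import Reals Lra.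
From Coquelicot Require Import Coquelicot.
Open Scope R_scope.

(** Put [n = f x f'] and [h = tanh xi], so that [|h| < 1].  Since [<f,f> = 1]
    and [<f',f'> = 1], the vectors [f], [f'], [n] form a pseudo-orthonormal
    frame with [n] time-like.  Let [k = det (f, f', f'')] be the geodesic
    curvature of [f].  Then [n' = f x f'' = - k f'] ([lcross_second_derivative]),
    and the fundamental theorem of calculus gives [gamma' = a (f + h n)]
    ([is_vderive_gamma_tilde]).  Hence [gamma] has the constant speed
    [L = sqrt (a^2 (1 - h^2))], its tangent is [T = (a / L) (f + h n)], and
    [T' = (a / L) (1 - h k) f'] is proportional to [f'].

    Consequently [T] and [f] have the same axes.  If [<f,u0>] is constant, then
    [<f',u0> = 0], so [<n,u0>' = - k <f',u0> = 0] and [<T,u0>] is constant.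
    Conversely, if [<T,d>] is constant, then [(1 - h k) <f',d> = 0]; the factor
    [1 - h k] does not vanish because [gamma] has a Frenet frame, so
    [<f',d> = 0] and [<f,d>] is constant.  Normalizing [d], which is space-like
    and non-zero, gives the centre of the pseudo-circle.

    The interval may contain its endpoints, where the derivatives are those of
    an extension of [f] that need not stay in de Sitter space.  A differentiable
    function that is constant on the interval nevertheless has zero derivative
    at the endpoints ([is_derive_const_on]), so the frame relations hold there
    too; the derivative of [T], which depends on the norm of [gamma'] off the
    interval, is computed at interior points only, and this is enough for the
    mean value theorem ([const_on_of_is_derive_0]). *)

(** * Calculus on an interval that may contain its endpoints *)

Definition interior_pt (I : R -> Prop) (t : R) : Prop :=
  exists p q, I p /\ I q /\ p < t < q.

Lemma interior_pt_in (I : R -> Prop) (t : R) :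
  interval I -> interior_pt I t -> I t.
Proof.
  intros [conv _] (p & q & Ip & Iq & Hpq).
  apply (conv p q t Ip Iq); lra.
Qed.

Lemma interior_pt_locally (I : R -> Prop) (t : R) :
  interval I -> interior_pt I t -> locally t I.
Proof.
  intros [conv _] (p & q & Ip & Iq & Hpq).
  assert (He : 0 < Rmin (t - p) (q - t)) by (apply Rmin_pos; lra).
  exists (mkposreal _ He); intros y Hy.
  apply Rabs_def2 in Hy; unfold minus, plus, opp in Hy; simpl in Hy.
  pose proof (Rmin_l (t - p) (q - t)); pose proof (Rmin_r (t - p) (q - t)).
  apply (conv p q y Ip Iq); lra.
Qed.

Lemma interval_accumulation (I : R -> Prop) (t eps : R) :
  interval I -> I t -> 0 < eps ->
  exists s, I s /\ s <> t /\ Rabs (s - t) < eps.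
Proof.
  intros [conv (p & q & Ip & Iq & Hpq)] It Heps.
  destruct (Rlt_dec t q) as [Htq | Htq].
  - pose proof (Rmin_l (q - t) (eps / 2)); pose proof (Rmin_r (q - t) (eps / 2)).
    assert (0 < Rmin (q - t) (eps / 2)) by (apply Rmin_pos; lra).
    exists (t + Rmin (q - t) (eps / 2)); split; [|split].
    + apply (conv t q); auto; lra.
    + lra.
    + apply Rabs_def1; lra.
  - pose proof (Rmin_l (t - p) (eps / 2)); pose proof (Rmin_r (t - p) (eps / 2)).
    assert (0 < Rmin (t - p) (eps / 2)) by (apply Rmin_pos; lra).
    exists (t - Rmin (t - p) (eps / 2)); split; [|split].
    + apply (conv p t); auto; lra.
    + lra.
    + apply Rabs_def1; lra.
Qed.

(** Every point of the interval is a limit of other points of it, along which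
    the difference quotients vanish. *)
Lemma is_derive_const_on (I : R -> Prop) (g : R -> R) (c t l : R) :
  interval I -> (forall s, I s -> g s = c) -> I t -> is_derive g t l -> l = 0.
Proof.
  intros HI Hg It Hd.
  destruct (Req_dec l 0) as [|Hl]; [assumption | exfalso].
  apply is_derive_Reals in Hd.
  destruct (Hd (Rabs l) (Rabs_pos_lt _ Hl)) as [delta Hdelta].
  destruct (interval_accumulation I t delta HI It (cond_pos delta))
    as (s & Is & Hst & Hs).
  specialize (Hdelta (s - t) ltac:(lra) Hs).
  replace (t + (s - t)) with s in Hdelta by ring.
  rewrite (Hg s Is), (Hg t It) in Hdelta.
  replace ((c - c) / (s - t) - l) with (- l) in Hdelta by (field; lra).
  rewrite Rabs_Ropp in Hdelta; lra.
Qed.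

Lemma const_on_of_is_derive_0 (I : R -> Prop) (g : R -> R) :
  interval I ->
  (forall t, I t -> ex_derive g t) ->
  (forall t, interior_pt I t -> is_derive g t 0) ->
  forall s t, I s -> I t -> g s = g t.
Proof.
  intros HI Hex Hd.
  assert (Hlt : forall s t, I s -> I t -> s < t -> g s = g t).
  { intros s t Is It Hst.
    destruct (MVT_gen g s t (fun _ => 0)) as (c & _ & Hc).
    - rewrite Rmin_left, Rmax_right by lra.
      intros x Hx; apply Hd; exists s, t; auto.
    - rewrite Rmin_left, Rmax_right by lra.
      intros x Hx; apply continuity_pt_filterlim.
      apply (ex_derive_continuous g x), Hex, (proj1 HI s t x Is It Hx).
    - lra. }
  intros s t Is It.
  destruct (Rtotal_order s t) as [H | [-> | H]]; auto; symmetry; auto.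
Qed.

(** At an endpoint [t] the integral must exist for upper bounds on both sides
    of [t]; continuity near [t] provides it beyond the interval. *)
Lemma is_derive_RInt_on (I : R -> Prop) (g : R -> R) (p t : R) :
  interval I -> (forall s, I s -> locally s (continuous g)) -> I p -> I t ->
  is_derive (RInt g p) t (g t).
Proof.
  intros [conv _] Hg Ip It.
  apply (is_derive_RInt g (RInt g p) p t).
  2: exact (locally_singleton _ _ (Hg t It)).
  destruct (Hg t It) as [eps Heps].
  exists eps; intros y Hy.
  apply (RInt_correct (V := R_CompleteNormedModule)).
  apply (ex_RInt_continuous (V := R_CompleteNormedModule)).
  intros z Hz.
  assert (Hcase : (p <= z <= t \/ t <= z <= p) \/ Rabs (z - t) < eps).
  { change (Rabs (y - t) < eps) in Hy.
    apply Rabs_def2 in Hy.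
    unfold Rmin, Rmax in Hz.
    destruct (Rle_dec p y); destruct (Rle_dec p z); destruct (Rle_dec z t);
      destruct (Rle_dec t z); destruct (Rle_dec z p);
      first [left; lra | right; apply Rabs_def1; lra]. }
  destruct Hcase as [[H | H] | H].
  - exact (locally_singleton _ _ (Hg z (conv p t z Ip It H))).
  - exact (locally_singleton _ _ (Hg z (conv t p z It Ip H))).
  - apply Heps, H.
Qed.

(** * Derivatives of curves in Minkowski space *)

Definition is_vderive (g : R -> V3) (t : R) (v : V3) : Prop :=
  is_derive (fun s => x1 (g s)) t (x1 v) /\
  is_derive (fun s => x2 (g s)) t (x2 v) /\
  is_derive (fun s => x3 (g s)) t (x3 v).

Lemma V3_ext (x y : V3) : x1 x = x1 y -> x2 x = x2 y -> x3 x = x3 y -> x = y.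
Proof.
  destruct x as [[a b] c], y as [[a' b'] c']; unfold x1, x2, x3; simpl.
  congruence.
Qed.

Lemma is_vderive_unique (g : R -> V3) (t : R) (v : V3) :
  is_vderive g t v -> vderive g t = v.
Proof.
  intros (H1 & H2 & H3).
  apply V3_ext; unfold vderive, x1, x2, x3 in *; simpl; now apply is_derive_unique.
Qed.

Lemma is_vderive_ext_loc (g k : R -> V3) (t : R) (v : V3) :
  locally t (fun s => g s = k s) -> is_vderive g t v -> is_vderive k t v.
Proof.
  intros Heq (H1 & H2 & H3); split; [|split];
    (eapply is_derive_ext_loc; [|eassumption]);
    apply (filter_imp (fun s => g s = k s)); auto; intros s ->; reflexivity.
Qed.

Lemma is_derive_Rmult (f g : R -> R) (t df dg : R) :
  is_derive f t df -> is_derive g t dg ->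
  is_derive (fun s => f s * g s) t (df * g t + f t * dg).
Proof.
  intros Hf Hg; apply (is_derive_mult f g); auto; intros; apply Rmult_comm.
Qed.

Lemma is_derive_Rplus (f g : R -> R) (t df dg : R) :
  is_derive f t df -> is_derive g t dg ->
  is_derive (fun s => f s + g s) t (df + dg).
Proof. intros Hf Hg; exact (is_derive_plus f g t df dg Hf Hg). Qed.

Lemma is_derive_Rminus (f g : R -> R) (t df dg : R) :
  is_derive f t df -> is_derive g t dg ->
  is_derive (fun s => f s - g s) t (df - dg).
Proof. intros Hf Hg; exact (is_derive_minus f g t df dg Hf Hg). Qed.

Lemma is_derive_ldot (g k : R -> V3) (t : R) (v w : V3) :
  is_vderive g t v -> is_vderive k t w ->
  is_derive (fun s => ldot (g s) (k s)) t (ldot v (k t) + ldot (g t) w).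
Proof.
  intros (G1 & G2 & G3) (K1 & K2 & K3); unfold ldot.
  evar_last.
  - apply is_derive_Rminus; [apply is_derive_Rplus|]; apply is_derive_Rmult; eassumption.
  - simpl; ring.
Qed.

Lemma is_vderive_lcross (g k : R -> V3) (t : R) (v w : V3) :
  is_vderive g t v -> is_vderive k t w ->
  is_vderive (fun s => lcross (g s) (k s)) t
             (vadd (lcross v (k t)) (lcross (g t) w)).
Proof.
  intros (G1 & G2 & G3) (K1 & K2 & K3).
  split; [|split]; unfold vadd, lcross, x1, x2, x3 in *; simpl;
    (evar_last; [apply is_derive_Rminus; apply is_derive_Rmult; eassumption
                | simpl; ring]).
Qed.

Lemma is_vderive_vadd (g k : R -> V3) (t : R) (v w : V3) :
  is_vderive g t v -> is_vderive k t w ->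
  is_vderive (fun s => vadd (g s) (k s)) t (vadd v w).
Proof.
  intros (G1 & G2 & G3) (K1 & K2 & K3).
  split; [|split]; unfold vadd, x1, x2, x3 in *; simpl; now apply is_derive_Rplus.
Qed.

Lemma is_vderive_vscal (c : R) (g : R -> V3) (t : R) (v : V3) :
  is_vderive g t v -> is_vderive (fun s => vscal c (g s)) t (vscal c v).
Proof.
  intros (G1 & G2 & G3).
  split; [|split]; unfold vscal, x1, x2, x3 in *; simpl; now apply is_derive_scal.
Qed.

Lemma is_vderive_const (d : V3) (t : R) : is_vderive (fun _ => d) t vzero.
Proof. split; [|split]; apply @is_derive_const. Qed.

Lemma is_derive_ldot_const (g : R -> V3) (d : V3) (t : R) (v : V3) :
  is_vderive g t v -> is_derive (fun s => ldot (g s) d) t (ldot v d).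
Proof.
  intros Hg; evar_last.
  - apply (is_derive_ldot g (fun _ => d) t v vzero Hg), is_vderive_const.
  - unfold ldot, vzero, x1, x2, x3; simpl; ring.
Qed.

Lemma is_vderive_vRInt (I : R -> Prop) (g : R -> V3) (p t : R) :
  interval I ->
  (forall s, I s -> locally s (fun y => exists v, is_vderive g y v)) ->
  I p -> I t -> is_vderive (vRInt g p) t (g t).
Proof.
  intros HI Hg Ip It.
  split; [|split]; unfold vRInt; simpl;
    [ apply (is_derive_RInt_on I (fun s => x1 (g s)))
    | apply (is_derive_RInt_on I (fun s => x2 (g s)))
    | apply (is_derive_RInt_on I (fun s => x3 (g s))) ]; auto;
    intros s Is; generalize (Hg s Is); apply filter_imp;
    intros y (v & H1 & H2 & H3); apply @ex_derive_continuous;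
    eexists; eassumption.
Qed.

Lemma smooth_on_derivatives (I : R -> Prop) (g : R -> R) (t : R) :
  smooth_on I g -> I t ->
  locally t (fun s => is_derive g s (Derive g s) /\
                      is_derive (Derive g) s (Derive (Derive g) s)).
Proof.
  intros Hg It.
  generalize (filter_and _ _ (Hg 1%nat t It) (Hg 2%nat t It)).
  apply filter_imp; intros s [H1 H2]; split; apply Derive_correct.
  - exact H1.
  - exact H2.
Qed.

Lemma smooth_curve_derivatives (I : R -> Prop) (f : R -> V3) (t : R) :
  smooth_curve I f -> I t ->
  locally t (fun s => is_vderive f s (vderive f s) /\
                      is_vderive (vderive f) s (vderive (vderive f) s)).
Proof.
  intros (H1 & H2 & H3) It.
  generalize (filter_and _ _ (smooth_on_derivatives I _ t H1 It)
               (filter_and _ _ (smooth_on_derivatives I _ t H2 It)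
                               (smooth_on_derivatives I _ t H3 It))).
  apply filter_imp; intros s ((A1 & B1) & (A2 & B2) & (A3 & B3)).
  split; (split; [|split]); assumption.
Qed.

(** * Lorentzian algebra *)

Ltac vring :=
  unfold ldot, vadd, vscal, lcross, vzero, x1, x2, x3 in *; simpl; ring.

Lemma ldot_sym (x y : V3) : ldot x y = ldot y x.
Proof. vring. Qed.

Lemma ldot_vscal_l (c : R) (x y : V3) : ldot (vscal c x) y = c * ldot x y.
Proof. vring. Qed.

Lemma ldot_lcross_l (x y : V3) : ldot (lcross x y) x = 0.
Proof. vring. Qed.

(** The Lagrange identity; its sign is opposite to the Euclidean one. *)
Lemma ldot_lcross_lcross (x y : V3) :
  ldot (lcross x y) (lcross x y) = ldot x y * ldot x y - ldot x x * ldot y y.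
Proof. vring. Qed.

Lemma lcross_self (x : V3) : lcross x x = vzero.
Proof. apply V3_ext; vring. Qed.

(** For independent [x], [y], [z] this expands [w] in the dual basis for [ldot],
    which consists of the three cross products divided by [det (x, y, z)]. *)
Lemma det_expansion (x y z w : V3) :
  vscal (ldot (lcross x y) z) w =
  vadd (vscal (ldot w x) (lcross y z))
       (vadd (vscal (ldot w y) (lcross z x)) (vscal (ldot w z) (lcross x y))).
Proof. apply V3_ext; vring. Qed.

(** With [x], [y], [z] the values of [f], [f'], [f''], this is
    [(f x f')' = - k f'] for the geodesic curvature [k = det (f, f', f'')].
    It is [det_expansion] of [y] itself, where only the coefficient [<y,y>]
    survives. *)
Lemma lcross_second_derivative (x y z : V3) :
  ldot y x = 0 -> ldot y y = 1 -> ldot y z = 0 ->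
  lcross x z = vscal (- ldot (lcross x y) z) y.
Proof.
  intros Hyx Hyy Hyz.
  pose proof (det_expansion x y z y) as H.
  rewrite Hyx, Hyy, Hyz in H.
  assert (H1 := f_equal x1 H); assert (H2 := f_equal x2 H);
    assert (H3 := f_equal x3 H).
  apply V3_ext; unfold vscal, vadd, lcross, x1, x2, x3 in *; simpl in *; lra.
Qed.

Lemma ldot_pos_of_spacelike (x : V3) :
  x <> vzero -> spacelike x -> 0 < ldot x x.
Proof. intros Hx [H | H]; [exact H | contradiction]. Qed.

Lemma lnorm_sqr (x : V3) : 0 < ldot x x -> lnorm x * lnorm x = ldot x x.
Proof.
  intros H; unfold lnorm; rewrite Rabs_pos_eq by lra.
  apply sqrt_sqrt; lra.
Qed.

Lemma lnorm_pos (x : V3) : 0 < ldot x x -> 0 < lnorm x.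
Proof.
  intros H; unfold lnorm; rewrite Rabs_pos_eq by lra; now apply sqrt_lt_R0.
Qed.

Lemma ldot_normalized (x : V3) :
  0 < ldot x x -> ldot (vscal (/ lnorm x) x) (vscal (/ lnorm x) x) = 1.
Proof.
  intros H; pose proof (lnorm_pos x H).
  rewrite ldot_vscal_l, ldot_sym, ldot_vscal_l, <- lnorm_sqr by exact H.
  field; lra.
Qed.

Lemma lnorm_unit (x : V3) : ldot x x = 1 -> lnorm x = 1.
Proof. intros H; unfold lnorm; rewrite H, Rabs_R1; apply sqrt_1. Qed.

Lemma tanh_sqr_lt_1 (x : R) : tanh x * tanh x < 1.
Proof.
  assert (Hc : 0 < cosh x).
  { unfold cosh; pose proof (exp_pos x); pose proof (exp_pos (- x)); lra. }
  assert (Hcs : cosh x * cosh x - sinh x * sinh x = 1).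
  { unfold cosh, sinh.
    assert (He : exp x * exp (- x) = 1).
    { rewrite <- exp_plus, Rplus_opp_r; apply exp_0. }
    lra. }
  assert (Hi : 0 < / (cosh x * cosh x)).
  { apply Rinv_0_lt_compat; apply Rmult_lt_0_compat; exact Hc. }
  replace (tanh x * tanh x) with (1 - / (cosh x * cosh x)); [lra|].
  unfold tanh.
  replace (sinh x / cosh x * (sinh x / cosh x))
    with ((sinh x * sinh x) / (cosh x * cosh x)) by (field; lra).
  replace (sinh x * sinh x) with (cosh x * cosh x - 1) by lra.
  field; lra.
Qed.

(** * The frame of a unit speed curve in de Sitter space *)

Definition conormal (f : R -> V3) (t : R) : V3 := lcross (f t) (vderive f t).

Definition geodesic_curvature (f : R -> V3) (t : R) : R :=
  ldot (conormal f t) (vderive (vderive f) t).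

Lemma is_vderive_curve (I : R -> Prop) (f : R -> V3) (t : R) :
  smooth_curve I f -> I t -> is_vderive f t (vderive f t).
Proof.
  intros Hf It.
  exact (proj1 (locally_singleton _ _ (smooth_curve_derivatives I f t Hf It))).
Qed.

Lemma is_vderive_velocity (I : R -> Prop) (f : R -> V3) (t : R) :
  smooth_curve I f -> I t ->
  is_vderive (vderive f) t (vderive (vderive f) t).
Proof.
  intros Hf It.
  exact (proj2 (locally_singleton _ _ (smooth_curve_derivatives I f t Hf It))).
Qed.

Lemma ldot_velocity (I : R -> Prop) (f : R -> V3) (t : R) :
  spacelike_curve I f -> unit_speed I f -> I t ->
  ldot (vderive f t) (vderive f t) = 1.
Proof.
  intros [_ Hs] Hu It.
  destruct (Hs t It) as [Hnz Hsp].
  rewrite <- lnorm_sqr by now apply ldot_pos_of_spacelike.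
  rewrite (Hu t It); ring.
Qed.

Lemma ldot_derivative_of_const_square (I : R -> Prop) (g : R -> V3) (c t : R)
  (v : V3) :
  interval I -> (forall s, I s -> ldot (g s) (g s) = c) -> I t ->
  is_vderive g t v -> ldot (g t) v = 0.
Proof.
  intros HI Hg It Hd.
  pose proof (is_derive_const_on I _ c t _ HI Hg It
                (is_derive_ldot g g t v v Hd Hd)) as H.
  rewrite (ldot_sym v) in H; lra.
Qed.

Section DeSitterCurve.

Variables (I : R -> Prop) (f : R -> V3).
Hypotheses (HI : interval I) (Hf : spacelike_curve I f)
  (Hu : unit_speed I f) (HS : forall t, I t -> de_sitter (f t)).

Lemma position_orthogonal_velocity (t : R) :
  I t -> ldot (f t) (vderive f t) = 0.
Proof.
  intros It; apply (ldot_derivative_of_const_square I f 1); auto.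
  apply (is_vderive_curve I); auto; apply Hf.
Qed.

Lemma velocity_orthogonal_acceleration (t : R) :
  I t -> ldot (vderive f t) (vderive (vderive f) t) = 0.
Proof.
  intros It; apply (ldot_derivative_of_const_square I _ 1); auto.
  - intros s Is; now apply (ldot_velocity I).
  - apply (is_vderive_velocity I); auto; apply Hf.
Qed.

Lemma is_vderive_conormal (t : R) :
  I t ->
  is_vderive (conormal f) t (vscal (- geodesic_curvature f t) (vderive f t)).
Proof.
  intros It; unfold geodesic_curvature, conormal.
  rewrite <- (lcross_second_derivative (f t) (vderive f t)).
  - replace (lcross (f t) (vderive (vderive f) t))
      with (vadd (lcross (vderive f t) (vderive f t))
                 (lcross (f t) (vderive (vderive f) t)))
      by (rewrite lcross_self; apply V3_ext; vring).
    apply is_vderive_lcross.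
    + apply (is_vderive_curve I); auto; apply Hf.
    + apply (is_vderive_velocity I); auto; apply Hf.
  - rewrite ldot_sym; now apply position_orthogonal_velocity.
  - now apply (ldot_velocity I).
  - now apply velocity_orthogonal_acceleration.
Qed.

(** * The curve built from the frame *)

Definition tangent_direction (h : R) (t : R) : V3 :=
  vadd (f t) (vscal h (conormal f t)).

Lemma is_vderive_tangent_direction (h t : R) :
  I t ->
  is_vderive (tangent_direction h) t
    (vscal (1 - h * geodesic_curvature f t) (vderive f t)).
Proof.
  intros It.
  replace (vscal (1 - h * geodesic_curvature f t) (vderive f t))
    with (vadd (vderive f t)
            (vscal h (vscal (- geodesic_curvature f t) (vderive f t))))
    by (apply V3_ext; vring).
  apply is_vderive_vadd.
  - apply (is_vderive_curve I); auto; apply Hf.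
  - apply is_vderive_vscal; now apply is_vderive_conormal.
Qed.

(** The minus sign comes from the conormal, which is time-like by the Lagrange
    identity. *)
Lemma ldot_tangent_direction (h t : R) :
  I t -> ldot (tangent_direction h t) (tangent_direction h t) = 1 - h * h.
Proof.
  intros It; unfold tangent_direction.
  assert (Hn : ldot (conormal f t) (conormal f t) = -1).
  { unfold conormal; rewrite ldot_lcross_lcross.
    rewrite position_orthogonal_velocity, (HS t It), (ldot_velocity I) by auto.
    ring. }
  assert (Hfn : ldot (conormal f t) (f t) = 0) by apply ldot_lcross_l.
  replace (ldot (vadd (f t) (vscal h (conormal f t)))
                (vadd (f t) (vscal h (conormal f t))))
    with (ldot (f t) (f t) + 2 * h * ldot (conormal f t) (f t)
          + h * h * ldot (conormal f t) (conormal f t))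
    by vring.
  rewrite Hn, Hfn, (HS t It); ring.
Qed.

Lemma is_vderive_gamma_tilde (a xi t : R) :
  I 0 -> I t ->
  is_vderive (gamma_tilde a xi f) t (vscal a (tangent_direction (tanh xi) t)).
Proof.
  intros I0 It.
  replace (vscal a (tangent_direction (tanh xi) t))
    with (vadd (vscal a (f t)) (vscal (a * tanh xi) (conormal f t)))
    by (apply V3_ext; unfold tangent_direction; vring).
  unfold gamma_tilde.
  apply is_vderive_vadd; apply is_vderive_vscal;
    apply (is_vderive_vRInt I); auto;
    intros s Is; generalize (smooth_curve_derivatives I f s (proj1 Hf) Is);
    apply filter_imp; intros y [H1 H2]; eexists.
  - exact H1.
  - now apply is_vderive_lcross; [exact H1 | exact H2].
Qed.

Definition bertrand_speed (a h : R) : R := sqrt (Rabs (a * a * (1 - h * h))).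

Lemma lnorm_vderive_gamma_tilde (a xi t : R) :
  I 0 -> I t ->
  lnorm (vderive (gamma_tilde a xi f) t) = bertrand_speed a (tanh xi).
Proof.
  intros I0 It.
  rewrite (is_vderive_unique _ _ _ (is_vderive_gamma_tilde a xi t I0 It)).
  unfold lnorm, bertrand_speed.
  rewrite ldot_vscal_l, ldot_sym, ldot_vscal_l, ldot_tangent_direction by auto.
  do 2 f_equal; ring.
Qed.

Lemma frenet_T_gamma_tilde (a xi t : R) :
  I 0 -> I t ->
  frenet_T (gamma_tilde a xi f) t =
  vscal (/ bertrand_speed a (tanh xi) * a) (tangent_direction (tanh xi) t).
Proof.
  intros I0 It; unfold frenet_T, Ds.
  rewrite (lnorm_vderive_gamma_tilde a xi t I0 It).
  rewrite (is_vderive_unique _ _ _ (is_vderive_gamma_tilde a xi t I0 It)).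
  apply V3_ext; vring.
Qed.

Lemma ldot_frenet_T_gamma_tilde (a xi t : R) :
  a <> 0 -> I 0 -> I t ->
  ldot (frenet_T (gamma_tilde a xi f) t) (frenet_T (gamma_tilde a xi f) t) = 1.
Proof.
  intros Ha I0 It.
  apply ldot_normalized.
  rewrite (is_vderive_unique _ _ _ (is_vderive_gamma_tilde a xi t I0 It)).
  rewrite ldot_vscal_l, ldot_sym, ldot_vscal_l, ldot_tangent_direction by auto.
  pose proof (tanh_sqr_lt_1 xi).
  pose proof (Rsqr_pos_lt a Ha) as Ha2; unfold Rsqr in Ha2.
  replace (a * (a * (1 - tanh xi * tanh xi)))
    with ((a * a) * (1 - tanh xi * tanh xi)) by ring.
  apply Rmult_lt_0_compat; lra.
Qed.

(** The derivative of the tangent is a multiple of [1 - h k], so a Frenet frame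
    excludes the vanishing of this factor.  Near an interior point the speed is
    constant, whence the restriction to such points. *)
Lemma frenet_curvature_factor (a xi t : R) :
  I 0 -> frenet_curve I (gamma_tilde a xi f) -> interior_pt I t ->
  1 - tanh xi * geodesic_curvature f t <> 0.
Proof.
  intros I0 [_ Hfr] Hint Hk.
  assert (It := interior_pt_in I t HI Hint).
  apply (proj1 (Hfr t It)).
  unfold Ds at 1.
  assert (HT : is_vderive (frenet_T (gamma_tilde a xi f)) t
            (vscal (/ bertrand_speed a (tanh xi) * a)
              (vscal (1 - tanh xi * geodesic_curvature f t) (vderive f t)))).
  { apply (is_vderive_ext_loc
             (fun s => vscal (/ bertrand_speed a (tanh xi) * a)
                             (tangent_direction (tanh xi) s))).
    - generalize (interior_pt_locally I t HI Hint); apply filter_imp.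
      intros s Is; symmetry; now apply frenet_T_gamma_tilde.
    - apply is_vderive_vscal; now apply is_vderive_tangent_direction. }
  rewrite (is_vderive_unique _ _ _ HT), Hk.
  apply V3_ext; vring.
Qed.

Lemma frenet_curve_gamma_tilde_neq0 (a xi : R) :
  I 0 -> frenet_curve I (gamma_tilde a xi f) -> a <> 0.
Proof.
  intros I0 [[_ Hreg] _] ->.
  apply (proj1 (Hreg 0 I0)).
  rewrite (is_vderive_unique _ _ _ (is_vderive_gamma_tilde 0 xi 0 I0 I0)).
  apply V3_ext; vring.
Qed.

Lemma helix_of_pseudo_circle (a xi : R) :
  a <> 0 -> I 0 ->
  part_of_pseudo_circle I f -> helix I (gamma_tilde a xi f).
Proof.
  intros Ha I0 (u0 & r & Hu0 & Hr).
  assert (Horth : forall t, I t -> ldot (vderive f t) u0 = 0).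
  { intros t It.
    apply (is_derive_const_on I (fun s => ldot (f s) u0) r t); auto.
    - intros s Is; apply (Hr s Is).
    - apply is_derive_ldot_const, (is_vderive_curve I); auto; apply Hf. }
  assert (Hd : forall t, I t ->
            is_derive (fun s => ldot (tangent_direction (tanh xi) s) u0) t 0).
  { intros t It; evar_last.
    - apply is_derive_ldot_const; now apply is_vderive_tangent_direction.
    - rewrite ldot_vscal_l, (Horth t It); ring. }
  exists u0, (angle_ratio (frenet_T (gamma_tilde a xi f) 0) u0).
  unfold de_sitter in Hu0; split; [|split].
  - intros ->; revert Hu0; unfold ldot, vzero, x1, x2, x3; simpl; lra.
  - left; lra.
  - intros t It; unfold angle_ratio.
    rewrite !(lnorm_unit (frenet_T _ _)) by now apply ldot_frenet_T_gamma_tilde.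
    rewrite !frenet_T_gamma_tilde, !ldot_vscal_l by auto.
    do 2 f_equal.
    apply (const_on_of_is_derive_0 I
             (fun s => ldot (tangent_direction (tanh xi) s) u0)); auto.
    + intros s Is; eexists; exact (Hd s Is).
    + intros s Hs; apply Hd; now apply interior_pt_in.
Qed.

Lemma pseudo_circle_of_helix (a xi : R) :
  I 0 -> frenet_curve I (gamma_tilde a xi f) ->
  helix I (gamma_tilde a xi f) -> part_of_pseudo_circle I f.
Proof.
  intros I0 Hfr (d & c & Hd0 & Hds & Hc).
  assert (Ha := frenet_curve_gamma_tilde_neq0 a xi I0 Hfr).
  assert (Hdd := ldot_pos_of_spacelike d Hd0 Hds).
  assert (Hdn := lnorm_pos d Hdd).
  set (m := / bertrand_speed a (tanh xi) * a).
  assert (HTd : forall t, I t ->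
            m * ldot (tangent_direction (tanh xi) t) d = c * lnorm d).
  { intros t It; rewrite <- (Hc t It); unfold angle_ratio.
    rewrite (lnorm_unit (frenet_T _ _)) by now apply ldot_frenet_T_gamma_tilde.
    rewrite frenet_T_gamma_tilde, ldot_vscal_l by auto.
    fold m; field; lra. }
  (* A unit tangent cannot be zero times the direction [f + h n]. *)
  assert (Hm : m <> 0).
  { intros H0.
    pose proof (ldot_frenet_T_gamma_tilde a xi 0 Ha I0 I0) as H.
    rewrite frenet_T_gamma_tilde, ldot_vscal_l in H by auto.
    fold m in H; rewrite H0 in H; lra. }
  assert (Horth : forall t, interior_pt I t -> ldot (vderive f t) d = 0).
  { intros t Ht.
    assert (It := interior_pt_in I t HI Ht).
    assert (H : m * ((1 - tanh xi * geodesic_curvature f t)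
                     * ldot (vderive f t) d) = 0).
    { apply (is_derive_const_on I
               (fun s => m * ldot (tangent_direction (tanh xi) s) d)
               (c * lnorm d) t); auto.
      apply is_derive_scal; rewrite <- ldot_vscal_l.
      apply is_derive_ldot_const; now apply is_vderive_tangent_direction. }
    apply Rmult_integral in H; destruct H as [H | H]; [contradiction|].
    apply Rmult_integral in H; destruct H as [H | H]; [|exact H].
    now destruct (frenet_curvature_factor a xi t I0 Hfr Ht). }
  assert (Hder : forall t, I t ->
            is_derive (fun s => ldot (f s) d) t (ldot (vderive f t) d)).
  { intros t It.
    apply is_derive_ldot_const, (is_vderive_curve I); auto; apply Hf. }
  exists (vscal (/ lnorm d) d), (/ lnorm d * ldot (f 0) d).
  split; [now apply ldot_normalized|].
  intros t It; split; [now apply HS|].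
  rewrite ldot_sym, ldot_vscal_l, ldot_sym; f_equal.
  apply (const_on_of_is_derive_0 I (fun s => ldot (f s) d)); auto.
  - intros s Is; eexists; exact (Hder s Is).
  - intros s Hs; rewrite <- (Horth s Hs).
    apply Hder; now apply interior_pt_in.
Qed.

End DeSitterCurve.

Theorem corollary1 (I : R -> Prop) (f : R -> V3) (a theta u : R)
  (hI : interval I) (h0 : I 0)
  (hf : spacelike_curve I f) (hunit : unit_speed I f)
  (hS : forall t, I t -> de_sitter (f t))
  (htheta : theta <> 0) (hu : 0 < u)
  (hB : bertrand I (gamma_tilde a (xi1 theta u) f)) :
  part_of_pseudo_circle I f <-> helix I (gamma_tilde a (xi1 theta u) f).
Proof.
  destruct hB as [Hfr _]; split.
  - apply helix_of_pseudo_circle; auto.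
    apply (frenet_curve_gamma_tilde_neq0 I f hI hf a (xi1 theta u)); auto.
  - apply pseudo_circle_of_helix; auto.
Qed.
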